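(* For all integers $k\geq 2$ and $n\geq 2$, the DCell network $D_{k,n}$ is super-$\lambda$, i.e. every minimum edge-cut of $D_{k,n}$ consists of the set of edges incident to a single vertex.
   Context: DCell $D_{k,n}$ ($n\geq 2$, $k\geq 0$) is defined recursively. $D_{0,n}$ is the complete graph $K_n$ on vertices $0,1,\dots,n-1$. Let $t_{k,n}=|V(D_{k,n})|$. For $k\geq1$, $D_{k,n}$ is built from $t_{k-1,n}+1$ disjoint copies $D^0_{k-1,n},\dots,D^{t_{k-1,n}}_{k-1,n}$ of $D_{k-1,n}$; a vertex of copy $D^i_{k-1,n}$ is labeled $(i,a_{k-1},\dots,a_0)$, where $(a_{k-1},\dots,a_0)$ is its label in $D_{k-1,n}$ (with $a_0\in\{0,\dots,n-1\}$), and its index within the copy is $uid_{k-1}=a_0+\sum_{l=1}^{k-1}a_l t_{l-1,n}$. For each pair $a<b$ of copy indices, one new edge (a level $k$ edge) joins the vertex of $D^a_{k-1,n}$ with $uid_{k-1}=b-1$ to the vertex of $D^b_{k-1,n}$ with $uid_{k-1}=a$. Edges of the base copies of $K_n$ are level $0$ edges; edges added at step $j$ are level $j$ edges. $D_{k,n}$ is $(n+k-1)$-regular. A graph is super-$\lambda$ if every minimum edge-cut isolates a single vertex. *)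

(* Defs.v *)
From HB Require Import structures.
From mathcomp Require Import all_boot.

Set Implicit Arguments.
Unset Strict Implicit.
Unset Printing Implicit Defensive.

(* A simple graph on a finType is given by its adjacency relation, which is
   meant to be symmetric and irreflexive; an edge is the set of its two ends. *)
Section EdgeCuts.
Variables (T : finType) (e : rel T).

Definition edges : {set {set T}} :=
  [set [set x; y] | x in [set: T], y in [set: T] & e x y].

Definition edges_at (v : T) : {set {set T}} := [set A in edges | v \in A].

Definition remove_edges (F : {set {set T}}) : rel T :=
  [rel x y | e x y && ([set x; y] \notin F)].

Definition edge_cut (F : {set {set T}}) : Prop :=
  F \subset edges /\ ~ (forall x y : T, connect (remove_edges F) x y).

Definition minimum_edge_cut (F : {set {set T}}) : Prop :=
  edge_cut F /\ (forall F' : {set {set T}}, edge_cut F' -> #|F| <= #|F'|).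

Definition super_lambda : Prop :=
  forall F : {set {set T}},
    minimum_edge_cut F -> exists v : T, F = edges_at v.

End EdgeCuts.

(* The label (a_k, a_(k-1), ..., a_0) is the nested pair
   (a_k, (a_(k-1), (..., a_0))); a_k ranges over the t_(k-1) + 1 copies of the
   graph one level below, with t_(k-1) the number of vertices of that graph. *)
Fixpoint dcell_vertex (k n : nat) : finType :=
  if k is k'.+1 then ('I_(#|dcell_vertex k' n|.+1) * dcell_vertex k' n)%type
  else 'I_n.

(* a_0 + \sum_(1 <= l <= k) a_l * t_(l-1) *)
Fixpoint dcell_uid (k n : nat) : dcell_vertex k n -> nat :=
  match k return dcell_vertex k n -> nat with
  | 0 => fun x => nat_of_ord x
  | k'.+1 => fun x => dcell_uid x.2 + nat_of_ord x.1 * #|dcell_vertex k' n|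
  end.

(* The edge of level k + 1 between the copies a < b joins x in copy a, of uid
   b - 1, to y in copy b, of uid a. *)
Definition dcell_link (k n : nat) (x y : dcell_vertex k.+1 n) : bool :=
  [&& x.1 < y.1, dcell_uid x.2 == y.1.-1 & dcell_uid y.2 == x.1].

Fixpoint dcell (k n : nat) : rel (dcell_vertex k n) :=
  match k return rel (dcell_vertex k n) with
  | 0 => fun x y => x != y
  | k'.+1 => fun x y =>
      [|| (x.1 == y.1) && dcell x.2 y.2, dcell_link x y | dcell_link y x]
  end.
Arguments dcell k n : clear implicits.

Lemma dcell_sym (k n : nat) : symmetric (dcell k n).
Proof.
elim: k => [|k IHk] x y /=; first by rewrite eq_sym.
by rewrite eq_sym IHk [dcell_link x y || _]orbC.
Qed.

Lemma dcell_irr (k n : nat) : irreflexive (dcell k n).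
Proof.
elim: k => [|k IHk] x /=; first by rewrite eqxx.
by rewrite IHk andbF /dcell_link ltnn.
Qed.

(* Main.v *)
Require Import Defs.
From mathcomp Require Import all_boot.
From mathcomp Require Import zify.

(** Write h = n + k - 1 for the degree of D_(k,n) and t for its order.  D_(k+1,n)
    is made of t + 1 copies of D_(k,n), any two of them joined by one edge, and
    every vertex has a neighbour outside its copy.  Assume that all nontrivial
    cuts of D_(k,n) have at least h edges, and let X and its complement have at
    least c vertices, where c is 1 or 2.  If X splits two copies, its cut has
    at least 2h edges.  If it splits at most one copy, contains one and misses
    another, then the edges from the contained to the missed copies number at
    least t - 1, and at least t when no copy is split.  Otherwise X (or its
    complement) lies in one copy, whose inner edges contribute h and the outer
    neighbours of X at least |X| >= c.  In all cases the cut has at least h + c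
    edges.  With c = 1 this shows inductively that the edge connectivity is the
    degree; with c = 2 it shows, at the last step, that a cut with at least two
    vertices on each side exceeds the degree. *)

Set Implicit Arguments.
Unset Strict Implicit.
Unset Printing Implicit Defensive.

(** * Edge cuts of a graph, seen through bipartitions of its vertices *)

Section Cuts.
Variables (T : finType) (e : rel T).
Hypotheses (e_sym : symmetric e) (e_irr : irreflexive e).

(** Only pairs directed out of [X] count, so each crossing edge counts once; the double sum can
    later be regrouped by copies. *)
Definition cut_size (X : {set T}) : nat :=
  \sum_x \sum_y [&& x \in X, y \notin X & e x y].

Lemma cut_size_setC (X : {set T}) : cut_size (~: X) = cut_size X.
Proof.
rewrite /cut_size exchange_big /=; apply: eq_bigr => x _; apply: eq_bigr => y _.
by rewrite !inE negbK e_sym; case: (x \in X); case: (y \in X).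
Qed.

Lemma cut_size_le_card (X : {set T}) (F : {set {set T}}) :
  (forall x y, x \in X -> y \notin X -> e x y -> [set x; y] \in F) ->
  cut_size X <= #|F|.
Proof.
move=> XF; pose C := [set p : T * T | [&& p.1 \in X, p.2 \notin X & e p.1 p.2]].
have -> : cut_size X = #|C|.
  rewrite /cut_size pair_bigA -sum1_card [RHS]big_mkcond /=.
  by apply: eq_bigr => p _; rewrite inE; case: ifP.
have inj_C : {in C &, injective (fun p => [set p.1; p.2])}.
  move=> [x y] [x' y']; rewrite !inE /= => /and3P[Xx Xy _] /and3P[Xx' Xy' _] E.
  have : x \in [set x'; y'] by rewrite -E !inE eqxx.
  have : y \in [set x'; y'] by rewrite -E !inE eqxx orbT.
  rewrite !inE => /orP[] /eqP Ey /orP[] /eqP Ex; subst => //.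
  - by rewrite Xx' in Xy.
  - by rewrite Xx' in Xy.
  - by rewrite Xx in Xy'.
rewrite -(card_in_imset inj_C); apply/subset_leq_card/subsetP => A /imsetP[p].
by rewrite inE => /and3P[Xx Xy exy] ->; apply: XF.
Qed.

Lemma card_edges_at (v : T) : #|edges_at e v| <= #|[set y | e v y]|.
Proof.
apply: leq_trans (leq_imset_card (fun y => [set v; y]) _).
apply/subset_leq_card/subsetP => A; rewrite inE => /andP[/imset2P[x y _]].
rewrite !inE /= => exy ->; rewrite !inE => /orP[] /eqP->; apply/imsetP.
  by exists y; rewrite ?inE.
by exists x; rewrite ?inE 1?e_sym // setUC.
Qed.

Lemma mem_edges_at (v y : T) : e v y -> [set v; y] \in edges_at e v.
Proof.
move=> evy; rewrite !inE eqxx andbT; apply/imset2P.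
by exists v y; rewrite ?inE.
Qed.

(** A path from [v] to another vertex would start with an edge at [v], and all of these are
    removed. *)
Lemma edges_at_edge_cut (v : T) : 1 < #|T| -> edge_cut e (edges_at e v).
Proof.
move=> T_gt1; split; first by apply/subsetP => A; rewrite inE => /andP[].
move=> conn; have [w wv] : exists w, w != v.
  apply/existsP; apply: contraLR T_gt1; rewrite negb_exists -leqNgt => /forallP all_v.
  apply/card_le1P => x _ y; rewrite [y \in _]inE inE.
  by have := all_v x; have := all_v y; rewrite !negbK => /eqP-> /eqP->; rewrite eqxx.
case/connectP: (conn v w) => -[|y p] /=; first by move=> _ E; rewrite E eqxx in wv.
by case/andP => /andP[/mem_edges_at ->].
Qed.

Lemma edges_at_subset (v : T) (F : {set {set T}}) :
  (forall y, e v y -> [set v; y] \in F) -> edges_at e v \subset F.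
Proof.
move=> vF; apply/subsetP => A; rewrite inE => /andP[/imset2P[x y _]].
rewrite !inE /= => exy ->; rewrite !inE => /orP[] /eqP E; subst v.
  exact: vF.
by rewrite setUC; apply: vF; rewrite e_sym.
Qed.

(** The vertex [v] only provides a reference degree. Take for [X] the vertices reachable from some
    [x] once [F] is removed: [F] contains all edges leaving [X], and minimality against the star of
    [v] bounds the cut of [X] by that degree. Hence one side is a single vertex, whose star lies in
    [F] and equals it by minimality. *)
Lemma super_lambda_cut_size (v : T) :
  1 < #|T| ->
  (forall X : {set T}, 1 < #|X| -> 1 < #|~: X| -> #|[set y | e v y]| < cut_size X) ->
  super_lambda e.
Proof.
move=> T_gt1 cutP F [[Fe Fcut] Fmin].
have FminE w : edges_at e w \subset F -> F = edges_at e w.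
  move=> wF; apply/esym/eqP.
  by rewrite eqEcard wF; apply: Fmin; apply: edges_at_edge_cut.
have [/'forall_forallP // | ] := boolP [forall x, forall y, connect (remove_edges e F) x y].
rewrite negb_forall => /existsP[x]; rewrite negb_forall => /existsP[y xy].
pose X := [set z | connect (remove_edges e F) x z].
have XF a b : a \in X -> b \notin X -> e a b -> [set a; b] \in F.
  rewrite !inE => xa xb eab; apply: contraR xb => abF.
  by apply: connect_trans xa (connect1 _); rewrite /remove_edges /= eab.
have cutX : cut_size X <= #|[set y | e v y]|.
  apply: leq_trans (card_edges_at v); apply: leq_trans (cut_size_le_card XF) _.
  by apply: Fmin; apply: edges_at_edge_cut.
have Xx : x \in X by rewrite inE.
have Xy : y \notin X by rewrite inE.
have [X1 | X_gt1] := leqP #|X| 1.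
  exists x; apply: FminE; apply: edges_at_subset => z exz; apply: XF => //.
  by apply/negP => Xz; move/card_le1_eqP: X1 => /(_ z x Xz Xx) E; rewrite E e_irr in exz.
have [X1 | XC_gt1] := leqP #|~: X| 1; last by have := cutP X X_gt1 XC_gt1; rewrite ltnNge cutX.
exists y; apply: FminE; apply: edges_at_subset => z eyz; rewrite setUC.
have CXy : y \in ~: X by rewrite inE.
apply: XF => //; last by rewrite e_sym.
apply/negP => /negP Xz.
have CXz : z \in ~: X by rewrite inE.
by move/card_le1_eqP: X1 => /(_ z y CXz CXy) E; rewrite E e_irr in eyz.
Qed.

End Cuts.

(** The cut has [a * b] edges with [a], [b] the sizes of the two sides, and [a * b >= a + b - 1] for
    positive [a], [b]. *)
Lemma cut_size_complete (T : finType) (X : {set T}) :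
  X != set0 -> X != setT -> #|T|.-1 <= cut_size (fun x y => x != y) X.
Proof.
move=> X0 XT.
have -> : cut_size (fun x y => x != y) X = #|X| * #|~: X|.
  rewrite /cut_size -sum_nat_const [RHS]big_mkcond; apply: eq_bigr => x _ /=.
  case: ifP => Xx; last by rewrite big1.
  rewrite -sum1_card [RHS]big_mkcond; apply: eq_bigr => y _ /=; rewrite inE.
  by case: (boolP (y \in X)) => //= Xy; case: eqP => // E; rewrite -E Xx in Xy.
have X_gt0 : 0 < #|X| by rewrite card_gt0.
have CX_gt0 : 0 < #|~: X| by rewrite card_gt0 -setCT (inj_eq (@setC_inj _)).
have := cardsC X; rewrite -cardsT; nia.
Qed.

(** * Copies of a graph, pairwise joined by an edge *)

Section Copies.
Variables (I T : finType) (eH : rel T) (e : rel (I * T)).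
Hypotheses (e_sym : symmetric e)
  (e_in : forall i x y, eH x y -> e (i, x) (i, y))
  (e_joined : forall i j, i != j -> exists x y, e (i, x) (j, y))
  (e_out : forall i x, exists2 q, q.1 != i & e (i, x) q).

Definition slice (X : {set I * T}) (i : I) : {set T} := [set x | (i, x) \in X].

Definition cut_between (X : {set I * T}) (i j : I) : nat :=
  \sum_x \sum_y [&& (i, x) \in X, (j, y) \notin X & e (i, x) (j, y)].

Lemma cut_size_between (X : {set I * T}) :
  cut_size e X = \sum_i \sum_j cut_between X i j.
Proof.
have big_pairE (F : I * T -> nat) : \sum_p F p = \sum_i \sum_x F (i, x).
  by rewrite pair_bigA; apply: eq_bigr => -[].
rewrite /cut_size big_pairE; apply: eq_bigr => i _.
by rewrite [RHS]exchange_big; apply: eq_bigr => x _; rewrite big_pairE.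
Qed.

Lemma cut_between_diag (X : {set I * T}) (i : I) :
  cut_size eH (slice X i) <= cut_between X i i.
Proof.
apply: leq_sum => x _; apply: leq_sum => y _; rewrite !inE.
have := @e_in i x y.
by case: (_ \in X); case: (_ \in X); case: (eH x y) => //= ->.
Qed.

Lemma cut_between_gt0 (X : {set I * T}) (i j : I) :
  i != j -> slice X i = setT -> slice X j = set0 -> 0 < cut_between X i j.
Proof.
move=> ij Xi Xj; have [x [y exy]] := e_joined ij.
have iX : (i, x) \in X by have := in_setT x; rewrite -Xi inE.
have jX : (j, y) \notin X by have := in_set0 y; rewrite -Xj inE => ->.
by rewrite /cut_between (bigD1 x) //= (bigD1 y) //= iX jX exy.
Qed.

Lemma slice_setC (X : {set I * T}) (i : I) : slice (~: X) i = ~: slice X i.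
Proof. by apply/setP => x; rewrite !inE. Qed.

Variables (h c : nat).
Hypotheses (h_gt0 : 0 < h) (c_gt0 : 0 < c) (ch : c <= h) (hcT : h + c <= #|T|)
  (cardI : #|I| = #|T|.+1)
  (cutH : forall Y : {set T}, Y != set0 -> Y != setT -> h <= cut_size eH Y).

Lemma cut_size_one_copy (X : {set I * T}) (m : I) :
  slice X m != setT -> (forall i, i != m -> slice X i = set0) -> c <= #|X| ->
  h + c <= cut_size e X.
Proof.
move=> XmT Xi cX.
have cardX : #|X| = #|slice X m|.
  have pair_inj : injective (pair m : T -> I * T) by move=> x y [].
  rewrite -(card_imset _ pair_inj); congr #|pred_of_set _|; apply/setP=> -[i x].
  apply/idP/imsetP => [Xix | [y Xy [-> ->]]]; last by move: Xy; rewrite inE.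
  have [E | im] := eqVneq i m; first by subst i; exists x; rewrite ?inE.
  by have := in_set0 x; rewrite -(Xi i im) inE Xix.
have Xm0 : slice X m != set0 by rewrite -card_gt0 -cardX; lia.
rewrite cut_size_between (bigD1 m) //= (bigD1 m) //=.
have inner := leq_trans (cutH Xm0 XmT) (cut_between_diag X m).
(* Each vertex of [X] has a neighbour in another copy, hence outside [X]; edges from distinct
   vertices of [X] are distinct. *)
suff outer : #|slice X m| <= \sum_(j | j != m) cut_between X m j by lia.
rewrite exchange_big -sum1_card [leqLHS]big_mkcond /=.
apply: leq_sum => x _; case: ifP => //; rewrite inE => Xx.
have [[j y] /= jm exy] := e_out m x.
have jX : (j, y) \notin X by have := in_set0 y; rewrite -(Xi j jm) inE => ->.
by rewrite (bigD1 j) //= (bigD1 y) //= Xx jX exy.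
Qed.

Lemma cut_size_no_full (X : {set I * T}) :
  (forall i, slice X i != setT) ->
  (forall i j, slice X i != set0 -> slice X j != set0 -> i = j) ->
  c <= #|X| -> h + c <= cut_size e X.
Proof.
move=> XT X0 cX; have /card_gt0P[[m x] Xmx] : 0 < #|X| by lia.
apply: (@cut_size_one_copy _ m) => // i im; apply/eqP; apply: contra_neqT im => Xi0.
by apply: X0 => //; apply/set0Pn; exists x; rewrite inE.
Qed.

(** The inner cuts of the two copies are disjoint, and [2 * h >= h + c] because [c <= h]. *)
Lemma cut_size_two_split (X : {set I * T}) (i j : I) : i != j ->
  slice X i != set0 -> slice X i != setT ->
  slice X j != set0 -> slice X j != setT -> h + c <= cut_size e X.
Proof.
move=> ij Xi0 XiT Xj0 XjT.
have row k : cut_between X k k <= \sum_l cut_between X k l.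
  by rewrite (bigD1 k) //= leq_addr.
rewrite cut_size_between (bigD1 i) //= [Z in _ <= _ + Z](bigD1 j) 1?eq_sym //=.
have := leq_trans (leq_trans (cutH Xi0 XiT) (cut_between_diag X i)) (row i).
have := leq_trans (leq_trans (cutH Xj0 XjT) (cut_between_diag X j)) (row j).
lia.
Qed.

Lemma cut_size_copies (X : {set I * T}) :
  c <= #|X| -> c <= #|~: X| -> h + c <= cut_size e X.
Proof.
move=> cX cCX.
(* Copies contained in [X], copies missed by [X], and below, in [M], copies split by [X]. *)
pose A := [set i | slice X i == setT]; pose B := [set i | slice X i == set0].
pose M := [set i | (slice X i != setT) && (slice X i != set0)].
have T_gt0 : 0 < #|T| by lia.
have [M1 | /card_gt1P[i [j [Mi Mj ij]]]] := leqP #|M| 1; last first.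
  move: Mi Mj; rewrite !inE => /andP[XiT Xi0] /andP[XjT Xj0].
  exact: cut_size_two_split ij Xi0 XiT Xj0 XjT.
have AB0 i : i \in A -> i \in B -> false.
  by rewrite !inE => /eqP-> /eqP/setP E; case/card_gt0P: T_gt0 => x _; have := E x; rewrite !inE.
have cardABM : #|A| + #|B| + #|M| = #|T|.+1.
  rewrite -cardI -!sum1_card (big_mkcond (fun i => i \in A)) (big_mkcond (fun i => i \in B)).
  rewrite (big_mkcond (fun i => i \in M)) /= -!big_split /=.
  apply: eq_bigr => i _; have := AB0 i; rewrite !inE.
  by case: eqP; case: eqP => //= _ _ /(_ isT isT).
(* A row of the double sum indexed by [A] meets every copy in [B]; a row indexed by [M] contributes
   [h] through its diagonal term. *)
have cutAB : #|A| * #|B| + \sum_(i in M) h <= cut_size e X.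
  rewrite cut_size_between -sum_nat_const (big_mkcond (fun i => i \in A)).
  rewrite (big_mkcond (fun i => i \in M)) -big_split /=.
  apply: leq_sum => i _; case: (boolP (i \in A)) => Ai.
    have -> : (i \in M) = false by move: Ai; rewrite !inE => ->.
    rewrite addn0 -sum1_card big_mkcond; apply: leq_sum => j _ /=; case: ifP => // Bj.
    apply: cut_between_gt0; last by move: Bj; rewrite inE => /eqP.
      by apply/eqP => E; have := AB0 i Ai; rewrite E Bj => /(_ isT).
    by move: Ai; rewrite inE => /eqP.
  case: ifP => //; rewrite inE => /andP[XiT Xi0]; rewrite (bigD1 i) //=.
  have := leq_trans (cutH Xi0 XiT) (cut_between_diag X i); lia.
rewrite sum_nat_const in cutAB.
have M_eq i j : i \in M -> j \in M -> i = j by move=> Mi Mj; apply: (card_le1_eqP M1).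
have [A0 | A_gt0] := posnP #|A|.
  have XT i : slice X i != setT by have := card0_eq A0 i; rewrite inE => ->.
  by apply: cut_size_no_full => // i j Xi0 Xj0; apply: M_eq; rewrite inE XT.
(* With no missed copy, the complement of [X] meets only the split copy, if any, and contains no
   full one. *)
have [B0 | B_gt0] := posnP #|B|.
  have X0 i : slice X i != set0 by have := card0_eq B0 i; rewrite inE => ->.
  rewrite -(cut_size_setC e_sym); apply: cut_size_no_full => // [i|i j].
    by rewrite slice_setC -setC0 (inj_eq (@setC_inj _)).
  rewrite !slice_setC -setCT !(inj_eq (@setC_inj _)) => XiT XjT.
  by apply: M_eq; rewrite inE X0 andbT.
(* Again [a * b >= a + b - 1]. One split copy: at least [#|T| - 1] edges besides the [h] inner ones.
   None: at least [#|T| >= h + c] edges. *)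
have [M0 | M_gt0] := posnP #|M|; last by nia.
by rewrite M0 in cutAB cardABM; nia.
Qed.

End Copies.

(** * DCell *)

Lemma dcell_uid_lt (k n : nat) (x : dcell_vertex k n) :
  dcell_uid x < #|dcell_vertex k n|.
Proof.
elim: k x => [|k IHk] x /=; first by rewrite card_ord.
rewrite card_prod card_ord (leq_trans (n := (x.1).+1 * #|dcell_vertex k n|)) //.
  by rewrite mulSn ltn_add2r.
exact: leq_mul (ltn_ord x.1) (leqnn _).
Qed.

(** Division by the order of a copy recovers the copy index as quotient and the inner uid as
    remainder. *)
Lemma dcell_uid_inj (k n : nat) : injective (@dcell_uid k n).
Proof.
elim: k => [|k IHk] /=; first exact: val_inj.
move=> [i x] [j y] /= E; have x_lt := dcell_uid_lt x; have y_lt := dcell_uid_lt y.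
have t_gt0 : 0 < #|dcell_vertex k n| by apply: leq_ltn_trans x_lt.
have Ej : i = j.
  apply: val_inj; have := congr1 (divn^~ #|dcell_vertex k n|) E.
  by rewrite /= !(addnC (dcell_uid _)) !divnMDl // !divn_small // !addn0.
by subst j; congr pair; apply: IHk; apply: addIn E.
Qed.

Lemma dcell_uid_surj (k n m : nat) :
  m < #|dcell_vertex k n| -> exists x : dcell_vertex k n, dcell_uid x = m.
Proof.
move=> m_lt; have /injectiveP uid_inj : injective
  (fun x : dcell_vertex k n => Ordinal (dcell_uid_lt x)).
  by move=> x y [] /dcell_uid_inj.
have := inj_card_onto (injectiveP _ uid_inj); rewrite card_ord.
by move=> /(_ (leqnn _) (Ordinal m_lt)) /codomP[x [E]]; exists x.
Qed.

Lemma dcell_joined (k n : nat) (i j : 'I_(#|dcell_vertex k n|.+1)) :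
  i != j -> exists x y, dcell k.+1 n (i, x) (j, y).
Proof.
wlog lt_ij : i j / i < j.
  move=> H ij; have [lt_ij | lt_ji | E] := ltngtP i j; first exact: H.
    have [||x [y exy]] := H j i => //; first by rewrite eq_sym.
    by exists y, x; rewrite dcell_sym.
  by rewrite (val_inj E) eqxx in ij.
have [x Ex] : exists x : dcell_vertex k n, dcell_uid x = j.-1.
  by apply: dcell_uid_surj; have := ltn_ord j; lia.
have [y Ey] : exists y : dcell_vertex k n, dcell_uid y = i.
  by apply: dcell_uid_surj; have := ltn_ord j; lia.
by exists x, y; rewrite /= /dcell_link /= lt_ij Ex Ey !eqxx orbT.
Qed.

(** With [u] the uid of [x], the neighbour lies in copy [u + 1] at uid [i] if [i <= u], and in copy
    [u] at uid [i - 1] otherwise. *)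
Lemma dcell_out (k n : nat) (i : 'I_(#|dcell_vertex k n|.+1)) (x : dcell_vertex k n) :
  exists2 q : dcell_vertex k.+1 n, q.1 != i & dcell k.+1 n (i, x) q.
Proof.
have x_lt := dcell_uid_lt x; have i_lt := ltn_ord i.
have [le_ix | lt_xi] := leqP i (dcell_uid x).
  have [y Ey] : exists y : dcell_vertex k n, dcell_uid y = i.
    by apply: dcell_uid_surj; lia.
  have j_lt : (dcell_uid x).+1 < #|dcell_vertex k n|.+1 by [].
  exists (Ordinal j_lt, y); first by rewrite -val_eqE /= gtn_eqF.
  by rewrite /= /dcell_link /= Ey ltnS le_ix !eqxx orbT.
have [y Ey] : exists y : dcell_vertex k n, dcell_uid y = i.-1.
  by apply: dcell_uid_surj; lia.
have j_lt : dcell_uid x < #|dcell_vertex k n|.+1 by lia.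
exists (Ordinal j_lt, y); first by rewrite -val_eqE /= ltn_eqF.
by rewrite /= /dcell_link /= Ey lt_xi !eqxx !orbT.
Qed.

Lemma dcell_degree (k n : nat) (x : dcell_vertex k n) :
  #|[set y | dcell k n x y]| <= n.-1 + k.
Proof.
elim: k x => [|k IHk] x.
  have -> : [set y | dcell 0 n x y] = [set~ x].
    by apply/setP => y; rewrite !inE eq_sym.
  by rewrite cardsC1 card_ord addn0.
case: x => i x.
pose inner := [set (i, y) | y in [set y | dcell k n x y]].
pose outer := [set y : dcell_vertex k.+1 n |
  dcell_link (i, x) y || dcell_link y (i, x)].
apply: (@leq_trans (#|inner| + #|outer|)).
  apply: leq_trans (leq_card_setU _ _).
  apply/subset_leq_card/subsetP => -[j y]; rewrite !inE /=.
  case/orP => [/andP[/eqP<- exy]|->]; last by rewrite orbT.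
  by apply/orP; left; apply/imsetP; exists y; rewrite ?inE.
have inner_le : #|inner| <= n.-1 + k.
  exact: leq_trans (leq_imset_card _ _) (IHk x).
suff : #|outer| <= 1 by rewrite addnS; lia.
(* Comparing [i] with the uid of [x] decides the direction of the link, and so fixes the other
   end. *)
have outerE q : q \in outer ->
  if i <= dcell_uid x then val q.1 = (dcell_uid x).+1 /\ dcell_uid q.2 = i
  else val q.1 = dcell_uid x /\ dcell_uid q.2 = i.-1.
  rewrite inE /dcell_link /= => /orP[] /and3P[lt_q /eqP Ex /eqP Ey].
    by rewrite Ex Ey -ltnS (ltn_predK lt_q) lt_q.
  by rewrite Ex Ey leqNgt lt_q.
apply/card_le1_eqP => -[j y] [j' y'] /outerE + /outerE.
suff pair_eq : val j' = val j /\ dcell_uid y' = dcell_uid y -> (j', y') = (j, y).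
  by case: ifP => _ /= [Ej Ey] [Ej' Ey']; apply: pair_eq; rewrite /= Ej Ej' Ey Ey'.
by case=> /val_inj -> /dcell_uid_inj ->.
Qed.

(** * Lower bounds for the cuts of DCell, by induction on the level *)

Lemma dcell_card_ge (k n : nat) : 1 < n -> n + k <= #|dcell_vertex k n|.
Proof.
move=> n_gt1; elim: k => [|k IHk] /=; first by rewrite card_ord addn0.
rewrite card_prod card_ord; move: #|dcell_vertex k n| IHk => t IHk; nia.
Qed.

Lemma dcell_cut_size_step (k n c : nat) (X : {set dcell_vertex k.+1 n}) :
  1 < n -> 0 < c -> c <= n.-1 + k -> n.-1 + k + c <= #|dcell_vertex k n| ->
  (forall Y : {set dcell_vertex k n}, Y != set0 -> Y != setT ->
     n.-1 + k <= cut_size (dcell k n) Y) ->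
  c <= #|X| -> c <= #|~: X| -> n.-1 + k + c <= cut_size (dcell k.+1 n) X.
Proof.
move=> n_gt1 c_gt0 c_le t_ge cutP cX cCX.
apply: (@cut_size_copies 'I_(#|dcell_vertex k n|.+1) _ (dcell k n)) => //.
- exact: (@dcell_sym k.+1 n).
- by move=> i x y /= ->; rewrite eqxx.
- exact: dcell_joined.
- exact: dcell_out.
- by lia.
- by rewrite card_ord.
Qed.

Lemma dcell_cut_size_ge (k n : nat) (X : {set dcell_vertex k n}) :
  1 < n -> X != set0 -> X != setT -> n.-1 + k <= cut_size (dcell k n) X.
Proof.
move=> n_gt1; elim: k X => [|k IHk] X X0 XT.
  by rewrite addn0; have := cut_size_complete X0 XT; rewrite card_ord.
(* The degree grows by one with each level, which is the case [c = 1]. *)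
rewrite addnS -addn1; apply: dcell_cut_size_step => //; try lia.
- have := dcell_card_ge k n_gt1; lia.
- by rewrite card_gt0.
- by rewrite card_gt0 -setCT (inj_eq (@setC_inj _)).
Qed.

Theorem theorem3 (k n : nat) (hk : 2 <= k) (hn : 2 <= n) :
  super_lambda (dcell k n).
Proof.
case: k hk => [|[|k]] // _.
(* The size condition for [c = 2]. It is one more than [dcell_card_ge] gives at this level, hence
   the product formula. For copies [K_n] it would read [n + 1 <= n]: this is where level at least 2
   matters. *)
have t_ge : n.-1 + k.+1 + 2 <= #|dcell_vertex k.+1 n|.
  have := dcell_card_ge k hn; rewrite /= card_prod card_ord.
  move: #|dcell_vertex k n| => t; nia.
have T_gt1 : 1 < #|dcell_vertex k.+2 n| by have := dcell_card_ge k.+2 hn; lia.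
have /card_gt0P[v _] : 0 < #|dcell_vertex k.+2 n| by lia.
apply: (super_lambda_cut_size (@dcell_sym _ _) (@dcell_irr _ _) (v := v)) => // X X_gt1 CX_gt1.
apply: leq_ltn_trans (dcell_degree v) _.
have : n.-1 + k.+1 + 2 <= cut_size (dcell k.+2 n) X; last by lia.
apply: dcell_cut_size_step => //; first by lia.
by move=> Y; apply: dcell_cut_size_ge.
Qed.
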